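(* For every real $r\ge 0$ there exists a finite set $\mathcal{S}_r$ of low-defect pairs such that: (1) each $(f,C)\in\mathcal{S}_r$ has degree at most $\lfloor r\rfloor$; and (2) for every $N\in A_r$ there exists some $(f,C)\in\mathcal{S}_r$ such that the augmented pair $(\hat f,C)$ efficiently $3$-represents $N$.
   Context: $\|n\|$ denotes the complexity of a positive integer $n$: the least number of $1$'s needed to write $n$ using $1$, addition, multiplication and parentheses. The defect is $\delta(n)=\|n\|-3\log_3 n$. For real $r\ge 0$, $A_r=\{n\in\mathbb{N}:\delta(n)<r\}$. For polynomials $f_1$ in $x_1,\dots,x_{r_1}$ and $f_2$ in $x_1,\dots,x_{r_2}$, $(f_1\otimes f_2)(x_1,\dots,x_{r_1+r_2})=f_1(x_1,\dots,x_{r_1})f_2(x_{r_1+1},\dots,x_{r_1+r_2})$. The set of low-defect pairs is the smallest subset $\mathscr{P}\subseteq\mathbb{Z}[x_1,x_2,\dots]\times\mathbb{N}$ such that: (i) for each positive integer constant $k$ and integer $C\ge\|k\|$, $(k,C)\in\mathscr{P}$; (ii) if $(f_1,C_1),(f_2,C_2)\in\mathscr{P}$ then $(f_1\otimes f_2,C_1+C_2)\in\mathscr{P}$; (iii) if $(f,C)\in\mathscr{P}$, $c$ a positive integer, $D\ge\|c\|$, then $(f\otimes x_1+c,C+D)\in\mathscr{P}$. A low-defect polynomial of degree $r$ is one in variables $x_1,\dots,x_r$ (degree = number of variables). For a low-defect pair $(f,C)$ with $f$ of degree $r$, the augmented polynomial is $\hat f=f\otimes x$, i.e. $\hat f(x_1,\dots,x_{r+1})=f(x_1,\dots,x_r)x_{r+1}$,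 and $(\hat f,C)$ is the augmented pair. We say $(\hat f,C)$ efficiently $3$-represents $N$ if there are nonnegative integers $n_1,\dots,n_{r+1}$ with $N=\hat f(3^{n_1},\dots,3^{n_{r+1}})$ and $\|N\|=C+3(n_1+\dots+n_{r+1})$. *)

(* Defs.v *)
From HB Require Import structures.
From mathcomp Require Import all_boot all_order all_algebra.
From mathcomp Require Import mpoly.
From mathcomp Require Import boolp classical_sets cardinality reals exp.

Set Implicit Arguments.
Unset Strict Implicit.
Unset Printing Implicit Defensive.

Import Order.TTheory GRing.Theory Num.Theory.
Local Open Scope ring_scope.

Inductive expr : Type :=
| One
| Add of expr & expr
| Mul of expr & expr.

Fixpoint value (e : expr) : nat :=
  match e with
  | One => 1
  | Add a b => value a + value b
  | Mul a b => value a * value b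
  end%N.

Fixpoint ones (e : expr) : nat :=
  match e with
  | One => 1
  | Add a b | Mul a b => ones a + ones b
  end%N.

Definition writable (n k : nat) : Prop :=
  exists e : expr, value e = n /\ ones e = k.

(* The value at n = 0, which no expression denotes, is the junk value 0;
   [complexityP] characterises the value at positive n. *)
Definition complexity (n : nat) : nat :=
  match pselect (exists k, `[< writable n k >]) with
  | left ex_k => ex_minn ex_k
  | right _ => 0%N
  end.

Lemma complexityP (n : nat) : (0 < n)%N ->
  writable n (complexity n) /\
  (forall k, writable n k -> (complexity n <= k)%N).
Proof.
move=> n_gt0; rewrite /complexity.
case: pselect => [ex_k | []].
  case: ex_minnP => m /asboolP wm m_min; split=> // k wk.
  by apply: m_min; apply/asboolP.
suff [e <-] : exists e, value e = n.
  by exists (ones e); apply/asboolP; exists e.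
elim: n n_gt0 => // -[|n] IHn _; first by exists One.
have [//|e ve] := IHn.
by exists (Add One e); rewrite /= ve.
Qed.

Definition log3 {R : realType} (x : R) : R := ln x / ln 3.

Definition defect (R : realType) (n : nat) : R :=
  (complexity n)%:R - 3 * log3 n%:R.

Definition A_ (R : realType) (r : R) : set nat :=
  [set n | (0 < n)%N /\ defect R n < r]%classic.

Definition tensor (r1 r2 : nat) (f1 : {mpoly int[r1]}) (f2 : {mpoly int[r2]}) :
    {mpoly int[r1 + r2]} :=
  (f1 \mPo [tuple 'X_(lshift r2 i) | i < r1]) *
  (f2 \mPo [tuple 'X_(rshift r1 i) | i < r2]).

Definition augment (r : nat) (f : {mpoly int[r]}) : {mpoly int[r + 1]} :=
  tensor f ('X_ord0 : {mpoly int[1]}).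

(* The index r is the number of variables, i.e. the degree of the pair. *)
Inductive is_low_defect : forall r : nat, {mpoly int[r]} -> nat -> Prop :=
| low_defect_const (k C : nat) :
    (0 < k)%N -> (complexity k <= C)%N ->
    is_low_defect (k%:Z)%:MP_[0] C
| low_defect_tensor (r1 r2 : nat) (f1 : {mpoly int[r1]})
    (f2 : {mpoly int[r2]}) (C1 C2 : nat) :
    is_low_defect f1 C1 -> is_low_defect f2 C2 ->
    is_low_defect (tensor f1 f2) (C1 + C2)%N
| low_defect_affine (r : nat) (f : {mpoly int[r]}) (C c D : nat) :
    is_low_defect f C -> (0 < c)%N -> (complexity c <= D)%N ->
    is_low_defect (tensor f ('X_ord0 : {mpoly int[1]}) + (c%:Z)%:MP_[r + 1])
      (C + D)%N.

Record low_defect_pair := LowDefectPair {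
  ld_degree : nat;
  ld_poly : {mpoly int[ld_degree]};
  ld_base : nat;
  ld_prop : is_low_defect ld_poly ld_base
}.

Definition efficiently_3_represents (m : nat) (g : {mpoly int[m]})
    (C N : nat) : Prop :=
  exists n : 'I_m -> nat,
    N%:Z = g.@[fun i => 3%:Z ^+ n i] /\
    complexity N = (C + 3 * \sum_(i < m) n i)%N.

(* Main.v *)
(* Fix [1/2 <= alpha < 1].  By induction on a most economical expression of N,
   either N is a positive power of 3 or N is represented by a low-defect pair of
   degree d and base C with [d alpha <= delta(N)] and [C <= K delta(N)], where K depends
   only on alpha.  Both bounds are additive under products, as is the defect.
   For a sum a + b with [b <= a], the defect grows from that of a by at least
   [||b|| - 2], and by at least alpha unless a lies below a bound depending on
   alpha; this pays for one more variable and for [||b||] more ones.  The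
   finitely many small sums are treated as constants, K being large enough for
   those that are not positive powers of 3, whose defect is positive.

   If [delta(N) < r <= alpha (floor r + 1)], then [d <= floor r] and C is bounded
   in terms of r, and only finitely many low-defect pairs have a given bound on
   their base. *)
Require Import Defs.
From mathcomp Require Import all_boot all_order all_algebra.
From mathcomp Require Import mpoly.
From mathcomp Require Import boolp classical_sets cardinality reals exp.
From mathcomp Require Import ring lra zify.

Set Implicit Arguments.
Unset Strict Implicit.
Unset Printing Implicit Defensive.

Import Order.TTheory GRing.Theory Num.Theory.
Local Open Scope ring_scope.

(** * Optimal expressions and the bound [n ^ 3 <= 3 ^ complexity n] *)

Lemma value_gt0 (e : expr) : (0 < value e)%N.
Proof. by elim: e => //= a IHa b IHb; rewrite ?muln_gt0 ?addn_gt0 IHa. Qed.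

Lemma ones_gt0 (e : expr) : (0 < ones e)%N.
Proof. by elim: e => //= a IHa b IHb; rewrite addn_gt0 IHa. Qed.

(** If [2 <= j], then [(a + b) ^ 3 <= 8 * a ^ 3 <= 3 ^ 2 * 3 ^ i]. If [j = 1], then [b = 1], as
    [2 ^ 3 > 3]; for [3 <= a] the factor [(1 + 1/a) ^ 3] is at most 64/27 < 3, and smaller [a] are
    checked directly. *)
Lemma cube_add_le (a b i j : nat) : (0 < b <= a)%N -> (0 < i)%N -> (0 < j)%N ->
  (a ^ 3 <= 3 ^ i -> b ^ 3 <= 3 ^ j -> (a + b) ^ 3 <= 3 ^ (i + j))%N.
Proof.
move=> /andP[b0 ba] i0 j0 ai bj; rewrite expnD.
have [j2|j1] := leqP 2 j.
  have : (3 ^ 2 <= 3 ^ j)%N by rewrite leq_exp2l.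
  have : ((a + b) ^ 3 <= (2 * a) ^ 3)%N by rewrite leq_exp2r // mul2n -addnn leq_add2l.
  by rewrite expnMn; move: (a ^ 3)%N ai => x; nia.
have ej : j = 1%N by lia.
have eb : b = 1%N.
  rewrite ej in bj; case: b b0 bj {ba} => [|[|b]] // _.
  by rewrite leqNgt (leq_trans (_ : 3 ^ 1 < 2 ^ 3)%N) // leq_exp2r.
rewrite ej eb expn1.
have [a3|] := leqP 3 a.
  suff : ((a + 1) ^ 3 <= 3 * a ^ 3)%N by lia.
  have : (27 * (a + 1) ^ 3 <= 64 * a ^ 3)%N.
    change (3 ^ 3 * (a + 1) ^ 3 <= 4 ^ 3 * a ^ 3)%N.
    by rewrite -!expnMn leq_exp2r //; lia.
  by lia.
case: a ai {ba} => [|[|[|a]]] // ai _.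
- by case: i i0 {ai} => // i _; rewrite (expnS 3 i); have := expn_gt0 3 i; lia.
- by case: i i0 {ai} => // i _; rewrite (expnS 3 i); have := expn_gt0 3 i; lia.
case: i i0 ai => [|[|i]] // _ _.
by rewrite (expnS 3 i.+1) (expnS 3 i); have := expn_gt0 3 i; lia.
Qed.

(** This is [||n|| >= 3 log_3 n] in integer form, so that the induction involves no logarithm. *)
Lemma value_cube_le (e : expr) : (value e ^ 3 <= 3 ^ ones e)%N.
Proof.
elim: e => //= a IHa b IHb; last by rewrite expnMn expnD leq_mul.
have [ab|/ltnW ba] := leqP (value a) (value b).
  by rewrite addnC (addnC (ones a)) cube_add_le ?ones_gt0 // value_gt0.
by rewrite cube_add_le ?ones_gt0 // value_gt0.
Qed.

Definition optimal (e : expr) : Prop := complexity (value e) = ones e.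

Lemma complexity_le (e : expr) : (complexity (value e) <= ones e)%N.
Proof. by have [_] := complexityP (value_gt0 e); apply; exists e. Qed.

Lemma optimal_exists (n : nat) : (0 < n)%N -> exists2 e, value e = n & optimal e.
Proof. by move=> /complexityP[[e [<- ones_e]] _]; exists e. Qed.

Lemma complexity_add_le (a b : nat) : (0 < a)%N -> (0 < b)%N ->
  (complexity (a + b) <= complexity a + complexity b)%N.
Proof.
move=> /optimal_exists[e <- ->] /optimal_exists[f <- ->].
exact: (complexity_le (Add e f)).
Qed.

Lemma complexity_mul_le (a b : nat) : (0 < a)%N -> (0 < b)%N ->
  (complexity (a * b) <= complexity a + complexity b)%N.
Proof.
move=> /optimal_exists[e <- ->] /optimal_exists[f <- ->].
exact: (complexity_le (Mul e f)).
Qed.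

Lemma optimal_Add (a b : expr) : optimal (Add a b) -> optimal a /\ optimal b.
Proof.
rewrite /optimal /= => eab.
have := complexity_add_le (value_gt0 a) (value_gt0 b).
by have := complexity_le a; have := complexity_le b; lia.
Qed.

Lemma optimal_Mul (a b : expr) : optimal (Mul a b) -> optimal a /\ optimal b.
Proof.
rewrite /optimal /= => eab.
have := complexity_mul_le (value_gt0 a) (value_gt0 b).
by have := complexity_le a; have := complexity_le b; lia.
Qed.

Lemma complexity_gt0 (n : nat) : (0 < n)%N -> (0 < complexity n)%N.
Proof. by move=> /optimal_exists[e <- ->]; exact: ones_gt0. Qed.

Lemma cube_le_complexity (n : nat) : (0 < n)%N -> (n ^ 3 <= 3 ^ complexity n)%N.
Proof. by move=> /optimal_exists[e <- ->]; exact: value_cube_le. Qed.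

Lemma complexity1 : complexity 1 = 1%N.
Proof.
by have := complexity_le One; have := @complexity_gt0 1 isT; rewrite /=; lia.
Qed.

Lemma complexity_pow3 (m : nat) : complexity (3 ^ m.+1) = (3 * m.+1)%N.
Proof.
apply/eqP; rewrite eqn_leq; apply/andP; split; last first.
  have := @cube_le_complexity (3 ^ m.+1); rewrite expn_gt0 => /(_ isT).
  by rewrite -expnM leq_exp2l // mulnC.
elim: m => [|m IHm].
  exact: (complexity_le (Add One (Add One One))).
rewrite expnS; apply: leq_trans (complexity_mul_le _ _) _; rewrite ?expn_gt0 //.
have := complexity_le (Add One (Add One One)); rewrite /= => c3.
by rewrite (mulnS 3 m.+1) leq_add.
Qed.

(** * The defect and its growth under products and sums *)

Section Defect.
Variable R : realType.
Local Notation delta := (defect R).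

Lemma ln3_gt0 : 0 < ln 3 :> R.
Proof. by rewrite ln_gt0 // ltr1n. Qed.

Lemma defectM (a b : nat) : (0 < a)%N -> (0 < b)%N ->
  complexity (a * b) = (complexity a + complexity b)%N ->
  delta (a * b) = delta a + delta b.
Proof.
move=> a0 b0 cab; rewrite /defect /log3 cab natrD natrM lnM ?posrE ?ltr0n //.
by rewrite mulrDl; ring.
Qed.

Lemma log3_le_of_cube (n k : nat) : (0 < n)%N -> (n ^ 3 <= 3 ^ k)%N ->
  3 * log3 n%:R <= k%:R :> R.
Proof.
move=> n0 nk; rewrite /log3 mulrA ler_pdivrMr ?ln3_gt0 //.
rewrite mulr_natl (mulr_natl _ k) -!lnXn ?ltr0n //.
by rewrite ler_ln ?posrE ?exprn_gt0 ?ltr0n // -!natrX ler_nat.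
Qed.

Lemma defect_ge0 (n : nat) : (0 < n)%N -> 0 <= delta n.
Proof. by move=> n0; rewrite subr_ge0 log3_le_of_cube // cube_le_complexity. Qed.

Lemma defect_pow3 (m : nat) : delta (3 ^ m.+1) = 0.
Proof.
rewrite /defect /log3 complexity_pow3 natrX lnXn ?ltr0n //.
have /lt0r_neq0 l3 := ln3_gt0.
by rewrite -(mulr_natl (ln 3)) natrM mulfK // subrr.
Qed.

(** Defect zero means [n ^ 3 = 3 ^ complexity n], so [n] divides a power of 3 and is itself one. The
    exponent 0 is excluded because [complexity 1 = 1] would give 1 = 3. *)
Lemma defect_gt0 (n : nat) : (0 < n)%N ->
  (exists m, n = 3 ^ m.+1)%N \/ 0 < delta n.
Proof.
move=> n0; have := defect_ge0 n0; rewrite le_eqVlt => /orP[/eqP d0|]; last by right.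
left; have : (n ^ 3 = 3 ^ complexity n)%N.
  apply/eqP; rewrite -(eqr_nat R) !natrX; apply/eqP; apply: (@ln_inj R).
  - by rewrite posrE exprn_gt0 // ltr0n.
  - by rewrite posrE exprn_gt0 // ltr0n.
  rewrite !lnXn ?ltr0n // -(mulr_natl (ln n%:R)) -(mulr_natl (ln 3)).
  have l3 : ln 3 != 0 :> R by rewrite gt_eqF ?ln3_gt0.
  have -> : (complexity n)%:R = 3 * log3 n%:R :> R.
    by apply/eqP; rewrite -subr_eq0; apply/eqP.
  by rewrite /log3 mulrA divfK.
move=> en; have : (n %| 3 ^ complexity n)%N by rewrite -en dvdn_exp.
case/(dvdn_pfactor _ _ (isT : prime 3)) => -[|m] _ nE; last by exists m.
by move: en (complexity_gt0 n0); rewrite nE expn0 exp1n complexity1.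
Qed.

Lemma defectD (a b : nat) : (0 < a)%N -> (0 < b)%N ->
  complexity (a + b) = (complexity a + complexity b)%N ->
  delta (a + b) =
  delta a + ((complexity b)%:R - 3 * log3 (1 + b%:R / a%:R)).
Proof.
move=> a0 b0 cab; rewrite /defect /log3 cab.
have -> : (a + b)%:R = a%:R * (1 + b%:R / a%:R) :> R.
  by rewrite mulrDr mulr1 mulrCA divff ?mulr1 ?natrD // pnatr_eq0 -lt0n.
rewrite lnM ?posrE ?ltr0n //; last by rewrite ltr_wpDr // divr_ge0.
by rewrite natrD mulrDl; ring.
Qed.

(** Since [b / a <= 1], the logarithmic term is at most [3 log_3 2], which is at most 2 because
    [2 ^ 3 <= 3 ^ 2]. *)
Lemma defectD_ge (a b : nat) : (0 < b <= a)%N ->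
  complexity (a + b) = (complexity a + complexity b)%N ->
  delta a + ((complexity b)%:R - 2) <= delta (a + b).
Proof.
move=> /andP[b0 ba] cab; have a0 := leq_trans b0 ba.
rewrite (defectD a0 b0 cab) lerD2l lerD2l lerN2.
apply: le_trans (@log3_le_of_cube 2 2 isT isT).
rewrite ler_wpM2l // /log3 ler_wpM2r ?invr_ge0 ?(ltW ln3_gt0) //.
have ba1 : b%:R / a%:R <= 1 :> R by rewrite ler_pdivrMr ?ltr0n // mul1r ler_nat.
have ba0 : 0 <= b%:R / a%:R :> R by rewrite divr_ge0.
by rewrite ler_ln ?posrE; lra.
Qed.

(* A summand of complexity at least 3 already costs [3 - 3 log_3 2 >= 1]; the
   summands 1 and 2 cost at least [1 - 3 log_3 (1 + 2/a)], which tends to 1. *)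
Lemma defectD_ge_alpha (alpha : R) : alpha < 1 -> exists M : nat,
  forall a b : nat, (0 < b <= a)%N -> (M <= a)%N ->
  complexity (a + b) = (complexity a + complexity b)%N ->
  delta a + alpha <= delta (a + b).
Proof.
move=> alpha1; have l3 := ln3_gt0.
(* For [b <= 2] and [a >= M], [3 ln (1 + b/a) / ln 3 <= 6 / (a ln 3) <= 1 - alpha]. *)
pose M := (Num.bound (6 / ((1 - alpha) * ln 3))).
exists M => a b bab Ma cab.
have [c3|c2] := leqP 3 (complexity b).
  apply: le_trans (defectD_ge bab cab); rewrite lerD2l.
  have : 3 <= (complexity b)%:R :> R by rewrite ler_nat.
  by lra.
have /andP[b0 ba] := bab; have a0 := leq_trans b0 ba.
have b2 : (b <= 2)%N.
  rewrite leqNgt; apply: contraL (cube_le_complexity b0) => b3; rewrite -ltnNge.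
  apply: leq_trans (_ : 3 ^ 3 <= _)%N; last by rewrite leq_exp2r.
  by rewrite ltn_exp2l.
rewrite (defectD a0 b0 cab) lerD2l.
have cb1 : 1 <= (complexity b)%:R :> R by rewrite ler1n complexity_gt0.
suff : 3 * log3 (1 + b%:R / a%:R) <= 1 - alpha by lra.
have ar0 : 0 < a%:R :> R by rewrite ltr0n.
have ba0 : 0 <= b%:R / a%:R :> R by rewrite divr_ge0.
rewrite /log3 mulrA ler_pdivrMr //.
have lnb : ln (1 + b%:R / a%:R) <= b%:R / a%:R :> R by rewrite le_ln1Dx //; lra.
suff : b%:R / a%:R <= (1 - alpha) * ln 3 / 3 :> R by lra.
have al0 : 0 < (1 - alpha) * ln 3 by rewrite mulr_gt0 ?subr_gt0.
rewrite ler_pdivrMr //; apply: le_trans (_ : 2 <= _); first by rewrite ler_nat.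
have : 6 / ((1 - alpha) * ln 3) < a%:R.
  apply: lt_le_trans (_ : M%:R <= _); last by rewrite ler_nat.
  by apply: archi_boundP; rewrite divr_ge0 // ltW.
by rewrite ltr_pdivrMr //; lra.
Qed.

(** Apart from positive powers of 3, finitely many numbers of positive defect are concerned; [K]
    grows by the ratio of complexity to defect of each. *)
Lemma small_complexity_le_defect (M : nat) : exists2 K : R, 0 < K &
  forall n : nat, (0 < n < M)%N ->
    (exists m, n = 3 ^ m.+1)%N \/ (complexity n)%:R <= K * delta n.
Proof.
elim: M => [|M [K K0 IHM]]; first by exists 1 => // n; lia.
have [M0|M0] := posnP M; first by exists 1 => // n; lia.
have [powM|dM] := defect_gt0 M0.
  exists K => // n /andP[n0]; rewrite ltnS leq_eqVlt => /orP[/eqP->|nM]; first by left.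
  by apply: IHM; rewrite n0.
have q0 : 0 <= (complexity M)%:R / delta M by rewrite divr_ge0 // ltW.
exists (K + (complexity M)%:R / delta M); first by rewrite ltr_wpDr.
move=> n /andP[n0]; rewrite ltnS leq_eqVlt => /orP[/eqP->|nM].
  by right; rewrite mulrDl divfK ?gt_eqF // lerDr mulr_ge0 // ltW.
have [|nK|nK] := IHM n; [by rewrite n0 | by left | right].
by apply: le_trans nK _; rewrite ler_wpM2r ?defect_ge0 // lerDl.
Qed.

End Defect.

(** * Evaluation of tensor products and representations by low-defect pairs *)

Lemma meval_tensor (r1 r2 : nat) (f1 : {mpoly int[r1]}) (f2 : {mpoly int[r2]})
    (v : 'I_(r1 + r2) -> int) :
  (tensor f1 f2).@[v] =
  f1.@[fun i => v (lshift r2 i)] * f2.@[fun i => v (rshift r1 i)].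
Proof.
rewrite /tensor mevalM !comp_mpoly_meval; congr (_ * _);
  by apply: meval_eq => i; rewrite tnth_mktuple mevalXU.
Qed.

Definition sum_fun (r1 r2 : nat) (n1 : 'I_r1 -> nat) (n2 : 'I_r2 -> nat)
    (i : 'I_(r1 + r2)) : nat :=
  match split i with inl j => n1 j | inr j => n2 j end.

Lemma sum_funl (r1 r2 : nat) (n1 : 'I_r1 -> nat) (n2 : 'I_r2 -> nat) (i : 'I_r1) :
  sum_fun n1 n2 (lshift r2 i) = n1 i.
Proof. by rewrite /sum_fun (unsplitK (inl i)). Qed.

Lemma sum_funr (r1 r2 : nat) (n1 : 'I_r1 -> nat) (n2 : 'I_r2 -> nat) (i : 'I_r2) :
  sum_fun n1 n2 (rshift r1 i) = n2 i.
Proof. by rewrite /sum_fun (unsplitK (inr i)). Qed.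

Lemma big_sum_fun (r1 r2 : nat) (n1 : 'I_r1 -> nat) (n2 : 'I_r2 -> nat) :
  (\sum_(i < r1 + r2) sum_fun n1 n2 i =
   \sum_(i < r1) n1 i + \sum_(i < r2) n2 i)%N.
Proof.
rewrite big_split_ord /=; congr (_ + _)%N; apply: eq_bigr => i _.
  exact: sum_funl.
exact: sum_funr.
Qed.

Lemma meval_tensor_sum_fun (r1 r2 : nat) (f1 : {mpoly int[r1]})
    (f2 : {mpoly int[r2]}) (n1 : 'I_r1 -> nat) (n2 : 'I_r2 -> nat) :
  (tensor f1 f2).@[fun i => 3%:Z ^+ sum_fun n1 n2 i] =
  f1.@[fun i => 3%:Z ^+ n1 i] * f2.@[fun i => 3%:Z ^+ n2 i].
Proof.
rewrite meval_tensor; congr (_ * _); apply: meval_eq => i;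
  by rewrite ?sum_funl ?sum_funr.
Qed.

(** Efficient 3-representation by an augmented pair, with the exponent [m] of the augmenting
    variable kept apart and with degree and base as parameters. *)
Definition represents (d C N : nat) : Prop :=
  exists (f : {mpoly int[d]}) (n : 'I_d -> nat) (m : nat),
    [/\ is_low_defect f C,
        N%:Z = f.@[fun i => 3%:Z ^+ n i] * 3%:Z ^+ m
      & complexity N = (C + 3 * (\sum_(i < d) n i + m))%N].

Lemma represents_const (k : nat) : (0 < k)%N -> represents 0 (complexity k) k.
Proof.
move=> k0; exists (k%:Z)%:MP_[0], (fun=> 0%N), 0%N; split.
- exact: low_defect_const.
- by rewrite mevalC expr0 mulr1.
- by rewrite big_ord0 muln0 addn0.
Qed.

Lemma represents_mul (d1 d2 C1 C2 a b : nat) :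
  represents d1 C1 a -> represents d2 C2 b ->
  complexity (a * b) = (complexity a + complexity b)%N ->
  represents (d1 + d2) (C1 + C2) (a * b).
Proof.
move=> [f1 [n1 [m1 [f1P aE ca]]]] [f2 [n2 [m2 [f2P bE cb]]]] cab.
exists (tensor f1 f2), (sum_fun n1 n2), (m1 + m2)%N; split.
- exact: low_defect_tensor.
- by rewrite PoszM aE bE meval_tensor_sum_fun exprD mulrACA.
- by rewrite cab ca cb big_sum_fun; lia.
Qed.

(** The power of 3 is absorbed by the augmenting variable, so neither degree nor base grows. *)
Lemma represents_mul_pow3 (d C a m : nat) : represents d C a ->
  complexity (a * 3 ^ m) = (complexity a + 3 * m)%N ->
  represents d C (a * 3 ^ m).
Proof.
move=> [f [n [k [fP aE ca]]]] cam; exists f, n, (k + m)%N; split=> //.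
- by rewrite PoszM aE exprD mulrA -(natz (3 ^ m)) natrX natz.
- by rewrite cam ca; lia.
Qed.

Lemma represents_pow3 (m : nat) : represents 0 3 (3 ^ m.+1).
Proof.
have c3 := complexity_pow3 0.
have r3 : represents 0 3 (3 ^ 1) by rewrite -[X in represents _ X]c3; exact: represents_const.
rewrite expnS; apply: represents_mul_pow3 => //.
by rewrite -[(3 * 3 ^ m)%N]expnS complexity_pow3 c3; lia.
Qed.

(** The exponent of the augmenting variable passes to the new variable of the affine step; the next
    augmenting variable gets exponent 0. *)
Lemma represents_add (d C a b : nat) : represents d C a -> (0 < b)%N ->
  complexity (a + b) = (complexity a + complexity b)%N ->
  represents (d + 1) (C + complexity b) (a + b).
Proof.
move=> [f [n [m [fP aE ca]]]] b0 cab.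
exists (tensor f ('X_ord0 : {mpoly int[1]}) + (b%:Z)%:MP_[d + 1]).
exists (sum_fun n (fun=> m)), 0%N; split.
- exact: low_defect_affine.
- by rewrite expr0 mulr1 mevalD mevalC meval_tensor_sum_fun mevalXU -aE PoszD.
- by rewrite cab ca big_sum_fun big_ord1; lia.
Qed.

Lemma represents_efficiently (d C N : nat) : represents d C N ->
  exists p : low_defect_pair,
    [/\ ld_degree p = d, ld_base p = C
      & efficiently_3_represents (augment (ld_poly p)) (ld_base p) N].
Proof.
move=> [f [n [m [fP NE cN]]]]; exists (LowDefectPair fP); split=> //=.
exists (sum_fun n (fun=> m)); split.
  by rewrite meval_tensor_sum_fun mevalXU.
by rewrite cN big_sum_fun big_ord1.
Qed.

(** * Degree and base bounded linearly by the defect *)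

Lemma represents_linear (R : realType) (alpha : R) : 2^-1 <= alpha < 1 ->
  exists2 K : R, 0 < K & forall N : nat, (0 < N)%N ->
    (exists m, N = 3 ^ m.+1)%N \/
    exists d C : nat, [/\ represents d C N, d%:R * alpha <= defect R N
                        & C%:R <= K * defect R N].
Proof.
move=> /andP[alpha_ge alpha_lt1].
have [M gainM] := defectD_ge_alpha alpha_lt1.
(* The bound covers all sums of two numbers at most [M], and also the number 1 when [M = 0]. *)
have [K0 K0_gt0 smallM] := small_complexity_le_defect R (M + M).+2.
exists (K0 + 20); first by lra.
move=> N /optimal_exists[e <-] {N}.
have smallP n : (0 < n < (M + M).+2)%N -> (exists m, n = 3 ^ m.+1)%N \/
    exists d C : nat, [/\ represents d C n, d%:R * alpha <= defect R n
                        & C%:R <= (K0 + 20) * defect R n].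
  move=> nM; have [|cn] := smallM n nM; [by left | right].
  have /andP[n0 _] := nM; have dn := defect_ge0 R n0.
  exists 0%N, (complexity n); split; first exact: represents_const.
    by rewrite mul0r.
  by apply: le_trans cn _; rewrite ler_wpM2r //; lra.
elim: e => [_|a IHa b IHb|a IHa b IHb] /=.
- exact: smallP.
- move=> oab; have [oa ob] := optimal_Add oab.
  move: oab IHa IHb (value_gt0 a) (value_gt0 b); rewrite /optimal /= -oa -ob.
  move: (value a) (value b) => x y cxy /(_ erefl) IHx /(_ erefl) IHy {a b oa ob}.
  wlog yx : x y cxy IHx IHy / (y <= x)%N => [hwlog|] x0 y0.
    have [yx|/ltnW xy] := leqP y x; first exact: hwlog.
    by rewrite addnC; apply: hwlog => //; rewrite addnC cxy addnC.
  have [xM|Mx] := ltnP x M.+1; first by apply: smallP; lia.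
  have yx' : (0 < y <= x)%N by rewrite y0.
  have gain1 := gainM x y yx' (ltnW Mx) cxy.
  have gain2 := defectD_ge R yx' cxy.
  have dx := defect_ge0 R x0.
  (* A positive power of 3 has defect 0 but is represented with base 3; the extra 3 treats both
     alternatives for [x] at once. *)
  right; have [d [C [rx dd dC]]] : exists d C : nat, [/\ represents d C x,
      d%:R * alpha <= defect R x & C%:R <= 3 + (K0 + 20) * defect R x].
    have [[m ->]|[d [C [rx dd dC]]]] := IHx.
      exists 0%N, 3%N; split; first exact: represents_pow3.
        by rewrite mul0r defect_pow3.
      by rewrite defect_pow3 mulr0 addr0.
    by exists d, C; split=> //; lra.
  exists (d + 1)%N, (C + complexity y)%N; split; first exact: represents_add.
    by rewrite natrD mulrDl mul1r; lra.
  (* [gain1] and [gain2] together say that the defect grows by at least the maximum [t] of [alpha]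
     and [complexity y - 2]. As [t >= 1/2], [3 + complexity y <= 5 + t <= 20 t], which is where the
     constant 20 suffices. *)
  rewrite natrD; apply: le_trans (_ : (K0 + 20) * (defect R x +
      Num.max alpha ((complexity y)%:R - 2)) <= _); last first.
    rewrite ler_wpM2l //; first by lra.
    by have [h|h] := leP alpha ((complexity y)%:R - 2); lra.
  rewrite mulrDr; suff : 3 + (complexity y)%:R <=
      (K0 + 20) * Num.max alpha ((complexity y)%:R - 2) by lra.
  apply: le_trans (_ : 20 * Num.max alpha ((complexity y)%:R - 2) <= _).
    by have [h|h] := leP alpha ((complexity y)%:R - 2); lra.
  by rewrite ler_wpM2r ?le_max; lra.
move=> oab; have [oa ob] := optimal_Mul oab.
move: oab IHa IHb (value_gt0 a) (value_gt0 b); rewrite /optimal /= -oa -ob.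
move: (value a) (value b) => x y cxy /(_ erefl) IHx /(_ erefl) IHy x0 y0 {a b oa ob}.
have dxy := defectM R x0 y0 cxy.
(* A factor that is a power of 3 only shifts an exponent; two such factors give a power of 3
   again. *)
have [[m xE]|[d1 [C1 [rx dx Cx]]]] := IHx.
  have [[k yE]|[d2 [C2 [ry dy Cy]]]] := IHy.
    by left; exists (m + k).+1; rewrite xE yE -expnD addSn addnS.
  right; exists d2, C2; rewrite dxy xE defect_pow3 add0r; split=> //.
  rewrite mulnC; apply: represents_mul_pow3 => //.
  by rewrite mulnC -xE cxy {1}xE complexity_pow3 addnC.
have [[k yE]|[d2 [C2 [ry dy Cy]]]] := IHy.
  right; exists d1, C1; rewrite dxy yE defect_pow3 addr0; split=> //.
  apply: represents_mul_pow3 => //.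
  by rewrite -yE cxy {1}yE complexity_pow3.
right; exists (d1 + d2)%N, (C1 + C2)%N; split; first exact: represents_mul.
- by rewrite dxy natrD mulrDl lerD.
- by rewrite dxy natrD mulrDr lerD.
Qed.

(** * Finiteness of the low-defect pairs of bounded base *)

Lemma is_low_defect_base_gt0 (r : nat) (f : {mpoly int[r]}) (C : nat) :
  is_low_defect f C -> (0 < C)%N.
Proof.
elim=> [k D k0 kD|r1 r2 f1 f2 C1 C2 _ C10 _ _|r' f' C' c D _ C'0 _ _].
- exact: leq_trans (complexity_gt0 k0) kD.
- by rewrite addn_gt0 C10.
- by rewrite addn_gt0 C'0.
Qed.

Lemma le_exp_complexity (n C : nat) : (complexity n <= C)%N -> (n <= 3 ^ C)%N.
Proof.
have [->//|n0] := posnP n; move=> nC.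
apply: leq_trans (_ : n ^ 3 <= _)%N; first by rewrite -{1}(expn1 n) leq_pexp2l.
by apply: leq_trans (cube_le_complexity n0) _; rewrite leq_exp2l.
Qed.

Local Open Scope classical_set_scope.

(** Pairs of all degrees in one type, without the proof component, so that the constructions of
    low-defect pairs become plain functions with finite images of finite sets. *)
Definition tagged_pair : Type := ({r : nat & {mpoly int[r]}} * nat)%type.

Definition tag_pair (r : nat) (f : {mpoly int[r]}) (C : nat) : tagged_pair :=
  (existT (fun r => {mpoly int[r]}) r f, C).

Definition tagged_tensor (p q : tagged_pair) : tagged_pair :=
  tag_pair (tensor (projT2 p.1) (projT2 q.1)) (p.2 + q.2).

Definition tagged_affine (p : tagged_pair) (c : nat * nat) : tagged_pair :=
  tag_pair (tensor (projT2 p.1) ('X_ord0 : {mpoly int[1]}) + (c.1%:Z)%:MP_[_])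
           (p.2 + c.2).

Definition low_defect_below (B : nat) : set tagged_pair :=
  [set p | is_low_defect (projT2 p.1) p.2 /\ (p.2 <= B)%N].

(** Bases and costs of constants are positive, so a pair of base at most [B.+1] is a constant or is
    built from pairs of base at most [B]; the constants are bounded by [le_exp_complexity]. *)
Lemma finite_low_defect_below (B : nat) : finite_set (low_defect_below B).
Proof.
elim: B => [|B IHB].
  apply: (sub_finite_set _ (finite_set0 _)) => -[[r f] C] /= [].
  by move=> /is_low_defect_base_gt0 /=; case: C.
(* Constants up to [3 ^ B.+1] with costs up to [B.+1]; the successors are due to the strict bound in
   the initial segments. *)
pose I := `I_(3 ^ B.+1).+1 `*` `I_B.+2.
have finI : finite_set I by apply: finite_setX; exact: finite_II.
pose consts := (fun c : nat * nat => tag_pair (c.1%:Z)%:MP_[0] c.2) @` I.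
pose tensors :=
  [set tagged_tensor p q | p in low_defect_below B & q in low_defect_below B].
pose affines := [set tagged_affine p c | p in low_defect_below B & c in I].
have fin : finite_set (consts `|` tensors `|` affines).
  rewrite !finite_setU; split; [split|].
  - exact: finite_image.
  - exact: finite_image2.
  - exact: finite_image2.
apply: sub_finite_set fin => -[[r f] C] [/=]; case.
- move=> k D k0 kD DB; left; left; exists (k, D) => //; split => /=; last by lia.
  by rewrite ltnS le_exp_complexity // (leq_trans kD).
- move=> r1 r2 f1 f2 C1 C2 f1P f2P CB; left; right.
  have := is_low_defect_base_gt0 f1P; have := is_low_defect_base_gt0 f2P.
  move=> C20 C10; exists (tag_pair f1 C1); first by split=> //=; lia.
  by exists (tag_pair f2 C2) => //; split=> //=; lia.
- move=> r' f' C' c D fP c0 cD CB; right.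
  have C'0 := is_low_defect_base_gt0 fP; have D0 := leq_trans (complexity_gt0 c0) cD.
  exists (tag_pair f' C'); first by split=> //=; lia.
  exists (c, D) => //; split => /=; last by lia.
  by rewrite ltnS le_exp_complexity // (leq_trans cD) //; lia.
Qed.

(** Forgetting the proof component is injective by proof irrelevance, so finiteness pulls back. *)
Lemma finite_low_defect_pair_below (B : nat) :
  finite_set [set p : low_defect_pair | (ld_base p <= B)%N].
Proof.
pose tag p := tag_pair (ld_poly p) (ld_base p).
have tag_inj : injective tag.
  move=> [r f C fP] [r' f' C' fP'] [] /= er ef eC.
  case: _ / er f' ef fP' => f' ef; case: _ / eC => fP'.
  have {}ef : f = f' by exact: existT_inj2 ef.
  by case: _ / ef fP' => fP'; rewrite (Prop_irrelevance fP fP').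
have fin := finite_preimage (in2W tag_inj) (finite_low_defect_below B).
by apply: sub_finite_set fin => p pB; split=> //=; exact: ld_prop.
Qed.

Local Close Scope classical_set_scope.

Theorem theorem4p15 (R : realType) (r : R) (r_ge0 : 0 <= r) :
  exists S : set low_defect_pair,
    [/\ finite_set S,
        forall p : low_defect_pair, S p -> (ld_degree p)%:Z <= Num.floor r
      & forall N : nat, A_ r N ->
          exists p : low_defect_pair, S p /\
            efficiently_3_represents (augment (ld_poly p)) (ld_base p) N].
Proof.
have rf0 : 0 <= (Num.floor r)%:~R :> R by rewrite ler0z floor_ge0.
have rf1 : r < (Num.floor r)%:~R + 1 by rewrite -[1]/(1%:~R) -intrD floorD1_gt.
set fl : R := (Num.floor r)%:~R in rf0 rf1.
(* The midpoint of [r / (fl + 1)] and 1 lies in [1/2, 1) and satisfies [r <= alpha * (fl + 1)]. *)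
pose alpha : R := (r / (fl + 1) + 1) / 2.
have q0 : 0 <= r / (fl + 1) by rewrite divr_ge0 //; lra.
have q1 : r / (fl + 1) < 1 by rewrite ltr_pdivrMr; lra.
have alphaP : 2^-1 <= alpha < 1 by rewrite /alpha; lra.
have [K K0 repK] := represents_linear alphaP.
(* The summand 3 admits the pair of base 3 that represents the positive powers of 3. *)
pose B := (Num.bound (K * r) + 3)%N.
exists [set p | (ld_base p <= B)%N /\ (ld_degree p)%:Z <= Num.floor r]%classic.
split.
- apply: sub_finite_set (finite_low_defect_pair_below B).
  by move=> p [].
- by move=> p [].
move=> N [N0 dN].
suff [d [C [/represents_efficiently[p [<- <- pN]] dr CB]]] : exists d C : nat,
    [/\ represents d C N, d%:Z <= Num.floor r & (C <= B)%N] by exists p.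
have [[m ->]|[d [C [rN dd dC]]]] := repK N N0.
  exists 0%N, 3%N; split; first exact: represents_pow3.
    by rewrite floor_ge0.
  by rewrite leq_addl.
exists d, C; split=> //.
  (* From [d * alpha <= defect R N < r <= (fl + 1) * alpha] follows [d < fl + 1], hence
     [d <= Num.floor r] by integrality. *)
  have : d%:R * alpha < (fl + 1) * alpha.
    apply: le_lt_trans dd _; apply: lt_le_trans dN _.
    by rewrite -ler_pdivrMl; [rewrite mulrC /alpha; lra | lra].
  rewrite ltr_pM2r; last by lra.
  by rewrite (pmulrn 1 d) -[X in _ + X]/(1%:~R) /fl -intrD ltr_int; lia.
apply: leq_trans (leq_addr 3 _); rewrite -(ler_nat R).
apply: le_trans dC _; apply: le_trans (_ : K * r <= _).
  by rewrite ler_wpM2l // ltW.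
by apply/ltW/archi_boundP; rewrite mulr_ge0 // ltW.
Qed.
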